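(* Let $C$ be a complete Boolean algebra (i.e. $\chi C=C$). Then the partially ordered set $\mathcal{B}(C,\chi)$ has a minimum if and only if $C$ is (isomorphic to) a power set Boolean algebra $\operatorname{Pow}(D)$ for some set $D$, and then the minimum is the finite/cofinite Boolean algebra on $D$.
   Context: $\mathbf{BA}$ is the category of Boolean algebras and Boolean homomorphisms. For $A\in\mathbf{BA}$, $\chi A$ denotes the completion of $A$, with embedding $\chi_A:A\to\chi A$; it is the maximum essential extension of $A$, i.e. a complete Boolean algebra containing (a copy of) $A$ as an order-dense subalgebra. $\mathcal{B}(C,\chi)=\{A\in\mathbf{BA}:\chi A=C\}$, whose members are regarded via $\chi_A$ as subalgebras of $C$ (those order-dense in $C$), partially ordered by inclusion. The finite/cofinite algebra on $D$ is the subalgebra of $\operatorname{Pow}(D)$ consisting of all finite and all cofinite subsets of $D$. *)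

(* Defs.v *)
From HB Require Import structures.
From mathcomp Require Import all_boot all_order.
From mathcomp Require Import boolp classical_sets functions cardinality.

Set Implicit Arguments.
Unset Strict Implicit.
Unset Printing Implicit Defensive.

Local Open Scope order_scope.
Local Open Scope classical_set_scope.

(* A Boolean algebra is a [ctbDistrLatticeType] (the one-element algebra,
   Pow of the empty set, is allowed).  Power set algebras are the library's
   Boolean algebras [set D], whose order is inclusion. *)

(* [{tblmorphism A -> B}] cannot be used here: despite its documentation, that
   structure only requires preservation of bottom and top. *)
Definition boolean_morphism dA (A : ctbDistrLatticeType dA)
    dB (B : ctbDistrLatticeType dB) (f : A -> B) : Prop :=
  [/\ Order.meet_morphism f, Order.join_morphism f,
      f \bot = \bot, f \top = \top &
      forall x : A, f (Order.compl x) = Order.compl (f x)].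

Definition boolean_isomorphism dA (A : ctbDistrLatticeType dA)
    dB (B : ctbDistrLatticeType dB) (f : A -> B) : Prop :=
  boolean_morphism f /\ bijective f.

Definition complete_algebra d (C : ctbDistrLatticeType d) : Prop :=
  forall S : set C, exists s : C, supremums S s.

Definition order_dense d (C : ctbDistrLatticeType d) (S : set C) : Prop :=
  forall c : C, c <> \bot -> exists2 a : C, S a & a <> \bot /\ a <= c.

Definition is_completion dA (A : ctbDistrLatticeType dA)
    dC (C : ctbDistrLatticeType dC) (e : A -> C) : Prop :=
  [/\ complete_algebra C, boolean_morphism e, injective e &
      order_dense (range e)].

(* The members of B(C, chi): the Boolean algebras A with chi A = C, each
   regarded as a subset of C through its completion embedding. *)
Definition algebras_completing_to d (C : ctbDistrLatticeType d) :
    set (set C) :=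
  [set S | exists (dA : Order.disp_t) (A : ctbDistrLatticeType dA)
             (e : A -> C), is_completion e /\ S = range e].

Arguments algebras_completing_to {d} C _.

Definition is_minimum T (P : set (set T)) (M : set T) : Prop :=
  P M /\ forall S, P S -> M `<=` S.

Definition fin_cofin (D : Type) : set (set D) :=
  [set X | finite_set X \/ cofinite_set X].

(* Main.v *)
Require Import Defs.
From HB Require Import structures.
From mathcomp Require Import all_boot all_order.
From mathcomp Require Import boolp classical_sets functions cardinality.

(** The algebras whose completion is [C] are, seen inside [C], the order-dense
    subalgebras of [C] ([algebras_completing_toE]), so the question is when
    there is a least order-dense subalgebra.

    A minimum forces [C] to be atomic ([atomic_of_minimum]).  The tool is a way
    of producing small dense subalgebras: if [U] and [V] are ultrafilters, the
    elements on which they agree, those in both or in neither, form a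
    subalgebra ([ultrafilter_agreement_subalgebra]).  It is dense as soon as
    neither contains an atom ([ultrafilter_agreement_dense]): an element in
    exactly one of them is not an atom, hence splits in two, and one of the
    halves is in neither.  Now suppose that there is no atom below some nonzero
    [b], and let [M] be the minimum.  Split [b] into nonzero disjoint parts [a]
    and [b `\` a], take a nonzero [m] in [M] below [a], and ultrafilters [U]
    containing [m] and [V] containing [b `\` a].  Both contain [b], so neither
    contains an atom, and [m] lies in [U] but not in [V]: their agreement
    algebra is a dense subalgebra that misses [m], which contradicts the
    minimality of [M].

    A complete atomic algebra is the power set of its set of atoms
    ([atoms_below_isomorphism]).

    Conversely, in a power set algebra the finite and cofinite sets form a
    dense subalgebra, and every dense subalgebra contains it: density puts a
    nonempty subset of each singleton, that is the singleton itself, in the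
    subalgebra ([dense_singleton]), and the finite and cofinite sets are
    generated by the singletons ([fin_cofin_sub_dense]). *)

Section BooleanAlgebras.
Import Order.Theory.
Local Open Scope classical_set_scope.
Local Open Scope order_scope.
Context {d : Order.disp_t} {C : ctbDistrLatticeType d}.
Implicit Types (S U V : set C) (p x y z : C).

(** * Dense subalgebras *)

Definition boolean_subalgebra S : Prop :=
  [/\ S \bot, forall x y, S x -> S y -> S (x `&` y)
    & forall x, S x -> S (~` x)].

Lemma boolean_subalgebraU S x y :
  boolean_subalgebra S -> S x -> S y -> S (x `|` y).
Proof.
move=> [_ SI SN] Sx Sy; rewrite -[_ `|` _]complK complU.
by apply/SN/SI; exact: SN.
Qed.

(** The members of [algebras_completing_to C] are given by abstract algebras,
    so a subalgebra has to be turned into a type with its own structure: the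
    subtype of its elements, with the operations inherited from [C]. *)
Lemma boolean_subalgebra_range S : boolean_subalgebra S ->
  exists (A : ctbDistrLatticeType d) (e : A -> C),
    [/\ boolean_morphism e, injective e & S = range e].
Proof.
move=> algS; have [S0 SI SN] := algS.
pose P : pred C := fun x => `[< S x >].
have PI : {in P &, forall x y, x `&` y \in P}.
  by move=> x y /asboolP Sx /asboolP Sy; apply/asboolP/SI.
have PU : {in P &, forall x y, x `|` y \in P}.
  by move=> x y /asboolP Sx /asboolP Sy; apply/asboolP; exact: boolean_subalgebraU.
have P0 : \bot \in P by apply/asboolP.
have P1 : \top \in P by apply/asboolP; rewrite -compl0; exact: SN.
have PN x : x \in P -> ~` x \in P by move=> /asboolP Sx; apply/asboolP/SN.
pose T := {x : C | P x}.
pose L := Order.SubChoice_isTBSubLattice.Build d C P d T PI PU P0 P1.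
pose B : Order.TBSubLattice.type P d := HB.pack T L.
have BU : left_distributive (Order.meet : B -> B -> B) Order.join.
  by move=> x y z; apply: val_inj; exact: meetUl.
pose DL := Order.Lattice_Meet_isDistrLattice.Build d B BU.
pose D : tbDistrLatticeType d := HB.pack T (Order.TBSubLattice.class B) DL.
pose compl (x : D) : D := exist _ (~` sval x) (PN _ (svalP x)).
have xC (x : D) : x `|` compl x = \top by apply: val_inj; exact: joinxC.
have xI (x : D) : x `&` compl x = \bot by apply: val_inj; exact: meetxC.
pose CL := Order.TBDistrLattice_hasComplement.Build d D xC xI.
pose A : ctbDistrLatticeType d := HB.pack T (Order.TBDistrLattice.class D) CL.
exists A, (sval : T -> C); split; last 2 first.
- exact: val_inj.
- apply/seteqP; split=> [x Sx|_ [x _ <-]]; last exact/asboolP/(svalP x).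
  by exists (exist _ x (asboolT Sx)).
- by split.
Qed.

Lemma algebras_completing_toE S : complete_algebra C ->
  algebras_completing_to C S <-> boolean_subalgebra S /\ order_dense S.
Proof.
move=> complC; split=> [[dA [A [e [[_ [eI _ e0 _ eN] _ dense] ->]]]]|].
  split=> //; split.
  - by exists \bot.
  - by move=> _ _ [a _ <-] [b _ <-]; exists (a `&` b).
  - by move=> _ [a _ <-]; exists (~` a).
move=> [/boolean_subalgebra_range [A [e [eM eI SE]]] dense].
by exists d, A, e; split=> //; split; rewrite -?SE.
Qed.

(** * Atoms *)

Definition is_atom p : Prop :=
  p <> \bot /\ forall x, x <= p -> x = \bot \/ x = p.

Definition atomic_algebra : Prop :=
  forall x, x <> \bot -> exists2 p, is_atom p & p <= x.

(** The two nonzero parts of [x] are [y] and its relative complement in [x]. *)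
Lemma nonatom_split x : x <> \bot -> ~ is_atom x ->
  exists y, [/\ y <> \bot, y <= x & x `\` y <> \bot].
Proof.
move=> x0 xNatom; apply: contrapT => noy; apply: xNatom; split=> // y yx.
have [->|y0] := pselect (y = \bot); first by left.
right; apply: contrapT => yNx; apply: noy; exists y; split=> // xy0.
by apply/yNx/le_anti; rewrite yx -diff_eq0 xy0 eqxx.
Qed.

(** The meet of [x] and an atom [p] is either [p] or [\bot]; hence [p] lies
    below [x] or below its complement, and this makes atoms prime. *)
Lemma atom_leP p x : is_atom p -> ~ p <= x -> p <= ~` x.
Proof.
move=> [_ atomp] pNx; rewrite -disj_leC.
have [->//|px] := atomp _ (leIl p x).
by case: pNx; rewrite leEmeet px.
Qed.

Lemma atom_le_join p x y : is_atom p -> p <= x `|` y -> p <= x \/ p <= y.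
Proof.
move=> atomp pxy; have [|pNx] := pselect (p <= x); [by left|right].
have := leI2 pxy (atom_leP p x atomp pNx).
by rewrite meetxx meetUl meetxC join0x => /le_trans; apply; exact: leIl.
Qed.

Lemma atom_leC p x : is_atom p -> (p <= ~` x) <-> ~ (p <= x).
Proof.
move=> atomp; split=> [pxC px|]; last exact: atom_leP.
have := leI2 px pxC; rewrite meetxx meetxC lex0 => /eqP.
by case: atomp.
Qed.

(** * Ultrafilters *)

Definition is_ultrafilter U : Prop :=
  [/\ ~ U \bot, forall x y, U x -> U y -> U (x `&` y),
      forall x y, U x -> x <= y -> U y & forall x, U x \/ U (~` x)].

(** Zorn's lemma is applied to the sets closed under meets and upwards whose
    elements all meet [x], rather than to the proper filters containing [x]:
    the union of the empty chain is empty, so the empty set has to qualify.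
    A maximal such set [U] contains every [y] that meets [x] together with each
    of its elements, because the filter generated by [U] and [y] still
    qualifies; if neither [y] nor its complement did, two elements of [U] would
    have a meet disjoint from [x]. *)
Lemma ultrafilter_exists x : x <> \bot -> exists2 U, is_ultrafilter U & U x.
Proof.
move=> x0.
pose P (F : set C) := [/\ forall y z, F y -> F z -> F (y `&` z),
  forall y z, F y -> y <= z -> F z & forall y, F y -> y `&` x <> \bot].
have [F totF|U [[UI Ule Ux] maxU]] := @Zorn_bigcup C P.
  move=> totF'; split=> [y z [X FX Xy] [Y FY Yz]|y z [X FX Xy] yz|y [X FX Xy]].
  - have [XY|YX] := totF' _ _ FX FY.
      by exists Y => //; have [YI _ _] := totF _ FY; apply: YI => //; exact: XY.
    by exists X => //; have [XI _ _] := totF _ FX; apply: XI => //; exact: YX.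
  - by exists X => //; have [_ Xle _] := totF _ FX; exact: Xle yz.
  - by have [_ _] := totF _ FX; exact.
have add y : (forall z, U z \/ z = \top -> z `&` y `&` x <> \bot) -> U y.
  move=> Uy; apply: contrapT => UNy.
  (* the alternative u = \top covers the case in which U is empty *)
  pose B := [set z | exists2 u, U u \/ u = \top & u `&` y <= z].
  apply: (maxU B).
    split=> [z Uz|BU]; first by exists z; [left|exact: leIl].
    by apply/UNy/BU; exists \top; [right|rewrite meet1x].
  split=> [z t [u Uu uz] [v Uv vt]|z t [u Uu uz] zt|z [u Uu uz] zx0].
  - exists (u `&` v).
      case: Uu => [Uu|->]; last by rewrite meet1x.
      by case: Uv => [Uv|->]; left; [exact: UI|rewrite meetx1].
    by rewrite -(meetxx y) meetACA leI2.
  - by exists u => //; exact: le_trans zt.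
  - by apply: (Uy u) => //; apply/le_anti; rewrite le0x andbT -zx0 leI2.
have U1 : U \top.
  by apply: add => z [Uz|->]; rewrite ?meetx1; [exact: Ux|rewrite meet1x].
have U1E z : U z \/ z = \top -> U z by move=> [//|->].
have UorN y : U y \/ U (~` y).
  have [|UNy] := pselect (U y); [by left|right].
  apply: (add) => z /U1E Uz zyx; apply: UNy; apply: (add) => t /U1E Ut tyx.
  apply: (Ux (z `&` t)); first exact: UI.
  apply/eqP; rewrite -lex0 -[z `&` t]meetx1 -(joinxC y) meetUr meetUl leUx.
  by rewrite -{1}tyx -zyx !leI2 ?leIl ?leIr.
exists U.
  by split=> // U0; apply: (Ux _ U0); rewrite meet0x.
by have [//|/Ux] := UorN x; rewrite meetCx.
Qed.

Lemma ultrafilterNP U x : is_ultrafilter U -> U (~` x) <-> ~ U x.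
Proof.
move=> [U0 UI _ UN]; split=> [UNx Ux|UNx]; last by case: (UN x).
by apply: U0; rewrite -(meetxC x); exact: UI.
Qed.

Lemma ultrafilter_agreement_subalgebra U V :
  is_ultrafilter U -> is_ultrafilter V ->
  boolean_subalgebra [set x | U x <-> V x].
Proof.
move=> uU uV; have [U0 UI Ule _] := uU; have [V0 VI Vle _] := uV.
split=> [|x y /= [UVx VUx] [UVy VUy]|x /= UVx].
- by split.
- by split=> [Uxy|Vxy]; [apply: VI; [apply: UVx|apply: UVy]
    |apply: UI; [apply: VUx|apply: VUy]];
    (apply: Ule Uxy _ || apply: Vle Vxy _); rewrite (leIl, leIr).
- by rewrite (ultrafilterNP U) // (ultrafilterNP V) // UVx.
Qed.

Definition nonprincipal U : Prop := forall p, is_atom p -> ~ U p.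

(** The element [x] is not an atom, and of two disjoint parts of [x] at most one
    belongs to [U]. *)
Lemma nonprincipal_split U x : is_ultrafilter U -> nonprincipal U -> U x ->
  exists y, [/\ y <> \bot, y <= x & ~ U y].
Proof.
move=> [U0 UI _ _] npU Ux.
have x0 : x <> \bot by move=> xE; apply: U0; rewrite -xE.
have [y [y0 yx xy0]] := nonatom_split x x0 (fun xA => npU x xA Ux).
have [Uy|UNy] := pselect (U y); last by exists y.
exists (x `\` y); split=> //; first exact: leBx.
by move=> Uxy; apply: U0; rewrite -(diffKI x y); exact: UI.
Qed.

(** If [x] is in [U] but not in [V], a part of [x] outside [U] is in neither
    of them, since [V] is closed upwards. *)
Lemma ultrafilter_agreement_dense U V :
  is_ultrafilter U -> is_ultrafilter V -> nonprincipal U -> nonprincipal V ->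
  order_dense [set x | U x <-> V x].
Proof.
move=> uU uV npU npV x x0; have [_ _ Ule _] := uU; have [_ _ Vle _] := uV.
have [UVx|UVx] := pselect (U x <-> V x); first by exists x.
have [Ux|UNx] := pselect (U x).
  have VNx : ~ V x by move=> Vx; apply: UVx.
  have [y [y0 yx UNy]] := nonprincipal_split U x uU npU Ux.
  by exists y => //=; split=> // Vy; case: VNx; exact: Vle yx.
have Vx : V x by apply: contrapT => VNx; apply: UVx.
have [y [y0 yx VNy]] := nonprincipal_split V x uV npV Vx.
by exists y => //=; split=> // Uy; case: UNx; exact: Ule yx.
Qed.

(** An atom in [U] meets [x], hence lies below it. *)
Lemma ultrafilter_atomless_nonprincipal U x : is_ultrafilter U -> U x ->
  (forall p, is_atom p -> ~ p <= x) -> nonprincipal U.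
Proof.
move=> uU Ux noatom p atomp Up; have [U0 UI _ _] := uU.
have /(atom_leP p x atomp) pxC := noatom p atomp.
have : U (p `&` x) by exact: UI.
by move: pxC; rewrite -disj_leC => /eqP ->.
Qed.

(** * A minimum forces atomicity *)

(** Below a nonzero [b] without atoms, two disjoint elements yield ultrafilters
    whose agreement algebra is dense but omits one of the two elements, which
    can be chosen in [M] since [M] is dense. *)
Lemma atomic_of_minimum M : complete_algebra C ->
  is_minimum (algebras_completing_to C) M -> atomic_algebra.
Proof.
move=> complC [/(algebras_completing_toE _ complC) [_ denseM] minM] b b0.
apply: contrapT => noatom.
have bA p : is_atom p -> ~ p <= b by move=> Ap pb; apply: noatom; exists p.
have [|a [a0 ab ba0]] := nonatom_split b b0.
  by move=> /bA; rewrite lexx.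
have [m Mm [m0 ma]] := denseM a a0.
have [U uU Um] := ultrafilter_exists m m0.
have [V uV Vba] := ultrafilter_exists (b `\` a) ba0.
have npU : nonprincipal U.
  apply: (ultrafilter_atomless_nonprincipal U m) => // p Ap pm.
  by apply: (bA p Ap); apply: le_trans pm (le_trans ma ab).
have npV : nonprincipal V.
  apply: (ultrafilter_atomless_nonprincipal V (b `\` a)) => // p Ap pba.
  by apply: (bA p Ap); apply: le_trans pba (leBx _ _).
have /minM /(_ m Mm) /= UVm : algebras_completing_to C [set x | U x <-> V x].
  apply/(algebras_completing_toE _ complC).
  split; first exact: ultrafilter_agreement_subalgebra.
  exact: ultrafilter_agreement_dense.
have [V0 VI _ _] := uV; apply: V0.
rewrite -(diffKI b a); apply: VI Vba.
by have [_ _ Vle _] := uV; apply: Vle ma; apply/UVm.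
Qed.

(** * Complete atomic algebras are power sets *)

Definition atoms_below x : set {p | is_atom p} := [set p | sval p <= x].

(** Atomicity makes the map reflect the order: if [x] is not below [y], an atom
    below [x `\` y] separates them.  Completeness provides the inverse, which
    sends a set of atoms to its supremum; an atom [p] outside a set [X] of atoms
    is not below that supremum, because the complement of [p] is an upper bound
    of [X]. *)
Lemma atoms_below_isomorphism : complete_algebra C -> atomic_algebra ->
  boolean_isomorphism atoms_below.
Proof.
move=> complC atomicC.
have belowN x : atoms_below (~` x) = ~` atoms_below x.
  apply/seteqP; split=> -[p Ap] /=; rewrite /atoms_below complEset /=;
    by have := atom_leC p x Ap; tauto.
split; first split=> //.
- by move=> x y; apply/seteqP; split=> -[p Ap];
    rewrite /atoms_below meetEset /= lexI => /andP.
- move=> x y; apply/seteqP; split=> -[p Ap]; rewrite /atoms_below joinEset /=.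
    exact: atom_le_join.
  by move=> [px|py]; [exact: lexUl|exact: lexUr].
- apply/seteqP; split=> -[p Ap] //; rewrite /atoms_below /= lex0 => /eqP.
  by case: Ap.
- by apply/seteqP; split=> -[p Ap] // _; rewrite /atoms_below /= lex1.
have sval_inj (p q : {p | is_atom p}) : sval p = sval q -> p = q.
  by case: p q => [p Ap] [q Aq] /=; exact: eq_exist.
pose sup (X : set {p | is_atom p}) : C :=
  sval (cid (complC [set p | exists2 q, X q & sval q = p])).
have supP X : supremums [set p | exists2 q, X q & sval q = p] (sup X).
  by rewrite /sup; case: cid.
have le_below x y : atoms_below x `<=` atoms_below y -> x <= y.
  move=> xy; rewrite -diff_eq0; apply/eqP; apply: contrapT => xy0.
  have [p Ap pxy] := atomicC _ xy0.
  have px : p <= x by apply: le_trans pxy (leBx _ _).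
  have /(atom_leC p y Ap) := le_trans pxy (leBC x y).
  by apply; apply: (xy (exist _ p Ap)).
exists sup => [x|X].
  have [ubx lubx] := supP (atoms_below x); apply/le_anti/andP; split.
    by apply: lubx => _ [q qx <-].
  by apply: le_below => p px; apply: ubx; exists p.
have [ubX lubX] := supP X.
apply/seteqP; split=> [p pX|p Xp]; last by apply: ubX; exists p.
apply: contrapT => XNp.
have /(atom_leC _ _ (svalP p)) : sval p <= ~` sup X; last exact.
rewrite lexC; apply: lubX => _ [q Xq <-]; rewrite lexC.
apply: (atom_leP _ _ (svalP p)) => pq; apply: XNp.
have [p0 _] := svalP p; have [_ /(_ _ pq)] := svalP q.
by case=> // /sval_inj ->.
Qed.

(** * The finite/cofinite algebra *)

Section FiniteCofinite.
Context {D : Type} {f : C -> set D} {g : set D -> C}.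
Hypothesis fM : boolean_morphism f.
Hypotheses (fK : cancel f g) (gK : cancel g f).

Lemma fin_cofin_subalgebra : boolean_subalgebra (f @^-1` fin_cofin (D := D)).
Proof.
have [fI _ f0 _ fN] := fM; split=> [|x y|x] /=.
- by left; rewrite f0.
- rewrite fI meetEset => -[fx _|cx [fy|cy]].
  + by left; exact: sub_finite_set fx.
  + by left; exact: sub_finite_set fy.
  + by right; rewrite cofinite_setI.
- by rewrite fN complEset => -[fx|cx]; [right; rewrite /= setCK|left].
Qed.

Lemma fin_cofin_dense : order_dense (f @^-1` fin_cofin (D := D)).
Proof.
have [fI _ f0 _ _] := fM => x x0.
have fset0 : f \bot = set0 := f0.
have [t ft] : f x !=set0.
  by apply/set0P/eqP => fx0; apply: x0; rewrite -(fK x) fx0 -fset0 fK.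
exists (g [set t]); first by rewrite /= gK; left; exact: finite_set1.
split=> [gt0|].
  have : f (g [set t]) = set0 by rewrite gt0 f0.
  by rewrite gK => /seteqP[/(_ t erefl)].
rewrite leEmeet -(inj_eq (can_inj fK)) fI gK meetEset.
by apply/eqP/setIidPl => _ ->.
Qed.

(** A nonzero element of [S] below [g [set t]] corresponds to a nonempty subset
    of the singleton, so it is [g [set t]]. *)
Lemma dense_singleton S t : order_dense S -> S (g [set t]).
Proof.
have [fI _ f0 _ _] := fM => denseS.
have fset0 : f \bot = set0 := f0.
have [|a Sa [a0]] := denseS (g [set t]).
  by move=> /(congr1 f); rewrite f0 gK => /seteqP[/(_ t erefl)].
rewrite leEmeet => /eqP /(congr1 f); rewrite fI gK meetEset => /setIidPl fat.
suff <- : a = g [set t] by [].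
have [fa0|fat1] := subset_set1 fat; first by case: a0; rewrite -(fK a) fa0 -fset0 fK.
by rewrite -fat1 fK.
Qed.

(** A finite set is a finite join of singletons, by induction on its
    cardinality, and a cofinite set is the complement of such a join. *)
Lemma fin_cofin_sub_dense S : boolean_subalgebra S -> order_dense S ->
  f @^-1` fin_cofin (D := D) `<=` S.
Proof.
move=> algS denseS; have [_ fU f0 _ fN] := fM; have [S0 _ SN] := algS.
have fset0 : f \bot = set0 := f0.
have Sfin X : finite_set X -> S (g X).
  move=> /finite_setP [n]; elim: n X => [|n IHn] X.
    by rewrite II0 card_eq0 => /eqP ->; rewrite -fset0 fK.
  move=> /eq_cardSP [t Xt /IHn SXt].
  suff -> : g X = g [set t] `|` g (X `\ t)%classic.
    by apply: boolean_subalgebraU => //; exact: dense_singleton.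
  by apply: (can_inj fK); rewrite fU !gK joinEset setD1K.
move=> x [/Sfin|]; first by rewrite fK.
by rewrite -complEset -fN => /Sfin; rewrite fK => /SN; rewrite complK.
Qed.

End FiniteCofinite.

Lemma fin_cofin_minimum (D : Type) (f : C -> set D) :
  complete_algebra C -> boolean_isomorphism f ->
  is_minimum (algebras_completing_to C) (f @^-1` fin_cofin (D := D)).
Proof.
move=> complC [fM [g fK gK]]; split.
  apply/(algebras_completing_toE _ complC).
  by split; [exact: fin_cofin_subalgebra|exact: fin_cofin_dense fK gK].
move=> S /(algebras_completing_toE _ complC) [algS denseS].
exact: fin_cofin_sub_dense fK gK _ algS denseS.
Qed.

End BooleanAlgebras.

Local Open Scope classical_set_scope.

Theorem theorem6p2 (d : Order.disp_t) (C : ctbDistrLatticeType d)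
    (C_complete : complete_algebra C) :
  ((exists M : set C, is_minimum (algebras_completing_to C) M) <->
   (exists (D : Type) (f : C -> set D), boolean_isomorphism f)) /\
  (forall (D : Type) (f : C -> set D), boolean_isomorphism f ->
     is_minimum (algebras_completing_to C) (f @^-1` fin_cofin (D := D))).
Proof.
split=> [|D f fI]; last exact: fin_cofin_minimum.
split=> [[M minM]|[D [f fI]]].
  exists {p : C | is_atom p}, atoms_below.
  exact: atoms_below_isomorphism (atomic_of_minimum M C_complete minM).
exists (f @^-1` fin_cofin (D := D)); exact: fin_cofin_minimum.
Qed.
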